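(* For all units $\mathbf{u}_1,\mathbf{u}_2$ of $E$, the norms $\|\cdot\|_{\mathbf{hu}_i}$ and $\|\cdot\|_{\mathbf{u}_j}$, $i,j\in\{1,2\}$, are equivalent.
   Context: $E\neq\{0\}$ is an Archimedean Riesz space (real vector lattice), with order $\leqslant$, lattice operations $\vee,\wedge$, positive cone $E_+$. Archimedean means: if $ny\leqslant x$ for all $n\in\mathbb{N}$ then $y\leqslant 0$. Notation: $x^+=x\vee 0$, $x^-=(-x)\vee 0$, $|x|=x\vee(-x)$. A unit of $E$ is an element $\mathbf{u}\in E_+$ such that for every $x\in E_+$ there is $n\in\mathbb{N}$ with $x\leqslant n\mathbf{u}$; $E$ is assumed to have one. For a unit $\mathbf{u}$ and $x\in E$, let $\mathbf{p}_{\mathbf{u}}(x)=\inf\{t\in\mathbb{R}:x\leqslant t\mathbf{u}\}$, $\|x\|_{\mathbf{u}}=\inf\{t\ge 0:|x|\leqslant t\mathbf{u}\}$ and $\|x\|_{\mathbf{hu}}=\mathbf{p}_{\mathbf{u}}(x^+)+\mathbf{p}_{\mathbf{u}}(x^-)$; both $\|\cdot\|_{\mathbf{u}}$ and $\|\cdot\|_{\mathbf{hu}}$ are norms on $E$, and $\|\cdot\|_{\mathbf{hu}_i}$ denotes the norm $\|\cdot\|_{\mathbf{hu}}$ for $\mathbf{u}=\mathbf{u}_i$. *)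

(* Defs.v *)
From HB Require Import structures.
From mathcomp Require Import all_boot all_order all_algebra.
From mathcomp Require Import classical_sets reals.

Set Implicit Arguments.
Unset Strict Implicit.
Unset Printing Implicit Defensive.

Import Order.TTheory GRing.Theory Num.Theory.
Local Open Scope ring_scope.

(* The lattice operations are fields of the mixin, and the Order.Lattice
   instance is derived from them: Hierarchy-Builder rejects a new structure
   inheriting from both Order.Lattice and GRing.Zmodule, since their join was not
   declared before Num.RealDomain. *)
HB.mixin Record POrderedLmodule_isRiesz (R : realType) E
    & Num.POrderedZmodule E & GRing.Lmodule R E := {
  riesz_meet : E -> E -> E;
  riesz_join : E -> E -> E;
  riesz_lexI : forall x y z : E,
    (x <= riesz_meet y z) = (x <= y) && (x <= z);
  riesz_leUx : forall x y z : E,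
    (riesz_join x y <= z) = (x <= z) && (y <= z);
  riesz_leD : forall x y z : E, x <= y -> x + z <= y + z;
  riesz_ge0Z : forall (a : R) (x : E), 0 <= a -> 0 <= x -> 0 <= a *: x;
}.

#[short(type="rieszType")]
HB.structure Definition Riesz (R : realType) :=
  { E of Num.POrderedZmodule E & GRing.Lmodule R E
       & POrderedLmodule_isRiesz R E }.

HB.instance Definition _ (R : realType) (E : rieszType R) :=
  Order.POrder_MeetJoin_isLattice.Build ring_display (Riesz.sort E)
    (@riesz_lexI R E) (@riesz_leUx R E).

Section RieszDefs.
Variables (R : realType) (E : rieszType R).
Implicit Types (x y u : E) (p q : E -> R).

Definition riesz_pos x : E := Order.join x 0.
Definition riesz_neg x : E := Order.join (- x) 0.
Definition riesz_abs x : E := Order.join x (- x).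

Definition riesz_archimedean : Prop :=
  forall x y, (forall n : nat, y *+ n <= x) -> y <= 0.

Definition riesz_unit u : Prop :=
  0 <= u /\ forall x, 0 <= x -> exists n : nat, x <= u *+ n.

(* The infima below are taken in R, where [inf] of an empty or unbounded-below
   set is 0; neither case arises when u is a unit and E is Archimedean and
   nontrivial. *)
Definition unit_gauge u x : R := inf [set t : R | x <= t *: u]%classic.

Definition unit_norm u x : R :=
  inf [set t : R | 0 <= t /\ riesz_abs x <= t *: u]%classic.

Definition hu_norm u x : R :=
  unit_gauge u (riesz_pos x) + unit_gauge u (riesz_neg x).

Definition equivalent_norms p q : Prop :=
  exists c C : R, [/\ 0 < c, 0 < C & forall x, c * p x <= q x <= C * p x].

End RieszDefs.

Arguments riesz_archimedean {R} E.

(* Main.v *)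
Require Import Defs.
From mathcomp Require Import all_boot all_order all_algebra.
From mathcomp Require Import classical_sets reals.

Set Implicit Arguments.
Unset Strict Implicit.
Unset Printing Implicit Defensive.

Import Order.TTheory GRing.Theory Num.Theory.
Local Open Scope ring_scope.

(** Everything is compared, up to equivalence, with the single norm
    [unit_norm u1].

    - Changing the unit: each unit is dominated by a positive multiple of the
      other, say [v <= K *: u]; then [`|x| <= t *: v] forces
      [`|x| <= (K * t) *: u], so [unit_norm u <= K * unit_norm v]
      ([unit_norm_equiv]).
    - Fixing the unit: [unit_norm u x] is the gauge of [`|x|], and the gauge is
      monotone and subadditive on the positive cone.  Since [x^+] and [x^-] are
      at most [`|x|], while [`|x|] is at most [x^+ + x^-], the norms
      [unit_norm u] and [hu_norm u] differ at most by a factor 2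
      ([hu_norm_equiv]).

    Since [E] is nontrivial, a unit is nonzero ([riesz_unit_gt0]).  This is what
    keeps the gauge of a positive element an honest infimum: the set of
    admissible [t] is then bounded below by [0] ([riesz_leZ_ge0]), and it is
    nonempty because [u] is a unit.

    Equivalence of norms being symmetric and transitive, this settles all
    pairs. *)

Section RieszOrder.
Variables (R : realType) (E : rieszType R).
Implicit Types (x y z u : E) (s t : R).

Lemma riesz_leD2 x y z w : x <= y -> z <= w -> x + z <= y + w.
Proof.
move=> xy zw; apply: (@le_trans _ _ (y + z)); first exact: riesz_leD.
by rewrite addrC (addrC y); apply: riesz_leD.
Qed.

Lemma riesz_subr_ge0 x y : (0 <= y - x) = (x <= y).
Proof.
apply/idP/idP => [/(@riesz_leD R E _ _ x)|/(@riesz_leD R E _ _ (- x))].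
  by rewrite subrK add0r.
by rewrite subrr.
Qed.

Lemma riesz_leZ t x y : 0 <= t -> x <= y -> t *: x <= t *: y.
Proof.
by move=> t0 xy; rewrite -riesz_subr_ge0 -scalerBr riesz_ge0Z ?riesz_subr_ge0.
Qed.

Lemma riesz_leZl s t u : 0 <= u -> s <= t -> s *: u <= t *: u.
Proof.
by move=> u0 st; rewrite -riesz_subr_ge0 -scalerBl riesz_ge0Z ?subr_ge0.
Qed.

Lemma riesz_pos_ge0 x : 0 <= riesz_pos x.
Proof. exact: leUr. Qed.

Lemma riesz_neg_ge0 x : 0 <= riesz_neg x.
Proof. exact: leUr. Qed.

(** Both [x] and [- x] lie below [`|x|], so [0 <= `|x| + `|x|]; halving gives
    the claim. *)
Lemma riesz_abs_ge0 x : 0 <= riesz_abs x.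
Proof.
have abs2 : 0 <= riesz_abs x + riesz_abs x.
  by rewrite -(subrr x) riesz_leD2 ?leUl ?leUr.
have half0 : 0 <= 2^-1 :> R by rewrite invr_ge0.
have := @riesz_ge0Z R E _ _ half0 abs2.
by rewrite -mulr2n -scaler_nat scalerA mulVf ?scale1r ?pnatr_eq0.
Qed.

Lemma riesz_pos_le_abs x : riesz_pos x <= riesz_abs x.
Proof. by rewrite leUx leUl riesz_abs_ge0. Qed.

Lemma riesz_neg_le_abs x : riesz_neg x <= riesz_abs x.
Proof. by rewrite leUx leUr riesz_abs_ge0. Qed.

Lemma riesz_abs_le_posDneg x : riesz_abs x <= riesz_pos x + riesz_neg x.
Proof.
rewrite leUx; apply/andP; split.
  by rewrite -[leLHS]addr0 riesz_leD2 ?riesz_neg_ge0 ?leUl.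
by rewrite -[leLHS]add0r riesz_leD2 ?riesz_pos_ge0 ?leUl.
Qed.

(** If [u = 0] then every [`|x|] is at most a multiple of [0], which squeezes
    [x] between [0] and [0]. *)
Lemma riesz_unit_gt0 u : (exists x : E, x != 0) -> riesz_unit u -> 0 < u.
Proof.
move=> [x x0] [u0 uP]; rewrite lt_def u0 andbT.
apply: contra x0 => /eqP uE.
have [n] := uP _ (riesz_abs_ge0 x); rewrite uE mul0rn leUx => /andP[xle0 Nxle0].
rewrite eq_le xle0 /=.
by move: Nxle0; rewrite -riesz_subr_ge0 opprK add0r.
Qed.

Lemma riesz_unit_bound u x : riesz_unit u -> 0 <= x ->
  exists2 K : R, 0 < K & x <= K *: u.
Proof.
move=> [u0 uP] /uP[n xn]; exists n.+1%:R => //.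
apply: le_trans xn _; rewrite -scaler_nat; apply: riesz_leZl => //.
by rewrite ler_nat.
Qed.

End RieszOrder.

Section Gauge.
Variables (R : realType) (E : rieszType R).
Implicit Types (x y u v : E) (t m : R).

(** A negative [t] would put [x] below [t *: u <= 0], hence [t *: u = 0] and
    [u = 0]. *)
Lemma riesz_leZ_ge0 u x t : 0 < u -> 0 <= x -> x <= t *: u -> 0 <= t.
Proof.
move=> u0 x0 xt; rewrite leNgt; apply/negP => t0.
have tu0 : t *: u <= 0 by rewrite -(scale0r u) riesz_leZl ?ltW.
have /eqP : t *: u == 0 by rewrite eq_le tu0 (le_trans x0 xt).
by move/eqP; rewrite scaler_eq0 lt_eqF //= gt_eqF.
Qed.

Lemma unit_gauge_le u x t : 0 < u -> 0 <= x -> x <= t *: u ->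
  unit_gauge u x <= t.
Proof.
move=> u0 x0 xt; apply: ge_inf => //.
by exists 0 => s /= ; apply: riesz_leZ_ge0.
Qed.

Lemma le_unit_gauge u x m : riesz_unit u -> 0 <= x ->
  (forall t, x <= t *: u -> m <= t) -> m <= unit_gauge u x.
Proof.
move=> uU x0 mP; apply: lb_le_inf; last by move=> t; apply: mP.
by have [K _ xK] := riesz_unit_bound uU x0; exists K.
Qed.

Lemma unit_normE u x : 0 < u -> unit_norm u x = unit_gauge u (riesz_abs x).
Proof.
move=> u0; congr inf; apply/seteqP; split=> t /= => [[]//|xt].
by split=> //; apply: riesz_leZ_ge0 xt => //; apply: riesz_abs_ge0.
Qed.

Lemma unit_gauge_mono u x y : 0 < u -> riesz_unit u -> 0 <= x -> x <= y ->
  unit_gauge u x <= unit_gauge u y.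
Proof.
move=> u0 uU x0 xy; apply: le_unit_gauge => // [|t yt].
  exact: le_trans xy.
by apply: unit_gauge_le => //; apply: le_trans yt.
Qed.

(** If [s] is admissible for [x] and [t] for [y], then [s + t] is admissible for
    [x + y]; the infimum is taken over [s] first, then over [t]. *)
Lemma unit_gaugeD u x y : 0 < u -> riesz_unit u -> 0 <= x -> 0 <= y ->
  unit_gauge u (x + y) <= unit_gauge u x + unit_gauge u y.
Proof.
move=> u0 uU x0 y0; rewrite -lerBlDr; apply: le_unit_gauge => // s xs.
rewrite lerBlDr -lerBlDl; apply: le_unit_gauge => // t yt.
rewrite lerBlDl; apply: unit_gauge_le => //; last first.
  by rewrite scalerDl riesz_leD2.
by rewrite -[0]addr0 riesz_leD2.
Qed.

(** Every [t] admissible for [v] gives [K * t] admissible for [u]. *)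
Lemma unit_gauge_le_unit u v x K : 0 < u -> 0 < v -> riesz_unit v ->
  0 < K -> v <= K *: u -> 0 <= x -> unit_gauge u x <= K * unit_gauge v x.
Proof.
move=> u0 v0 vU K0 vK x0; rewrite -ler_pdivrMl //.
apply: le_unit_gauge => // t xt; rewrite ler_pdivrMl //.
apply: unit_gauge_le => //; apply: (le_trans xt).
by rewrite mulrC -scalerA riesz_leZ // (riesz_leZ_ge0 v0 x0).
Qed.

End Gauge.

Section EquivalentNorms.
Variables (R : realType) (E : rieszType R).
Implicit Types (p q r : E -> R) (u v : E).

Lemma equivalent_norms_sym p q : equivalent_norms p q -> equivalent_norms q p.
Proof.
move=> [c [C [c0 C0 pq]]]; exists C^-1, c^-1; split; rewrite ?invr_gt0 //.
by move=> x; rewrite ler_pdivrMl // ler_pdivlMl // andbC.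
Qed.

Lemma equivalent_norms_trans p q r :
  equivalent_norms p q -> equivalent_norms q r -> equivalent_norms p r.
Proof.
move=> [c [C [c0 C0 pq]]] [d [D [d0 D0 qr]]].
exists (d * c), (D * C); split; rewrite ?mulr_gt0 // => x.
have /andP[cp pC] := pq x; have /andP[dq qD] := qr x.
rewrite -!mulrA; apply/andP; split.
  by apply: le_trans dq; rewrite ler_pM2l.
by apply: (le_trans qD); rewrite ler_pM2l.
Qed.

Lemma hu_norm_equiv u : 0 < u -> riesz_unit u ->
  equivalent_norms (hu_norm u) (unit_norm u).
Proof.
move=> u0 uU; exists 2^-1, 1; split; rewrite ?invr_gt0 // => x.
have x0 := riesz_abs_ge0 x.
have p0 := riesz_pos_ge0 x; have n0 := riesz_neg_ge0 x.
rewrite unit_normE // mul1r ler_pdivrMl // mulr_natl mulr2n.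
apply/andP; split.
  by apply: lerD; apply: unit_gauge_mono => //;
    [exact: riesz_pos_le_abs | exact: riesz_neg_le_abs].
apply: le_trans (unit_gaugeD u0 uU p0 n0).
by apply: unit_gauge_mono => //; apply: riesz_abs_le_posDneg.
Qed.

Lemma unit_norm_equiv u v : 0 < u -> riesz_unit u -> 0 < v -> riesz_unit v ->
  equivalent_norms (unit_norm u) (unit_norm v).
Proof.
move=> u0 uU v0 vU.
have [K K0 uK] := riesz_unit_bound vU (ltW u0).
have [L L0 vL] := riesz_unit_bound uU (ltW v0).
exists L^-1, K; split; rewrite ?invr_gt0 // => x.
have x0 := riesz_abs_ge0 x.
by rewrite !unit_normE // ler_pdivrMl // !unit_gauge_le_unit.
Qed.

End EquivalentNorms.

Theorem lemma4 (R : realType) (E : rieszType R)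
    (E_neq0 : exists x : E, x != 0)
    (E_arch : riesz_archimedean E)
    (u1 u2 : E) (u1_unit : riesz_unit u1) (u2_unit : riesz_unit u2)
    (N N' : E -> R)
    (N_in : [set hu_norm u1; hu_norm u2;
                 unit_norm u1; unit_norm u2]%classic N)
    (N'_in : [set hu_norm u1; hu_norm u2;
                  unit_norm u1; unit_norm u2]%classic N') :
  equivalent_norms N N'.
Proof.
have u1_gt0 := riesz_unit_gt0 E_neq0 u1_unit.
have u2_gt0 := riesz_unit_gt0 E_neq0 u2_unit.
have to_unit_norm u M : 0 < u -> riesz_unit u ->
    M = hu_norm u \/ M = unit_norm u -> equivalent_norms M (unit_norm u1).
  move=> u_gt0 u_unit M_in.
  apply: (equivalent_norms_trans (q := unit_norm u)).
    by case: M_in => ->; [exact: hu_norm_equiv | exact: unit_norm_equiv].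
  exact: unit_norm_equiv.
have via_u1 M : [set hu_norm u1; hu_norm u2;
    unit_norm u1; unit_norm u2]%classic M -> equivalent_norms M (unit_norm u1).
  by move=> [[[]|]|] ->; [apply: (to_unit_norm u1)|apply: (to_unit_norm u2)
    |apply: (to_unit_norm u1)|apply: (to_unit_norm u2)]; auto.
apply: equivalent_norms_trans (via_u1 _ N_in) _.
exact: equivalent_norms_sym (via_u1 _ N'_in).
Qed.
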